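(* For $n\in\mathbb N$ let $0=x_{n,0}<x_{n,1}<\dots<x_{n,l_n}=1$ and let $c_{n,i}:[0,1]\to[0,\infty)$, $i=0,\dots,l_n$, satisfy $\sum_{i=0}^{l_n}c_{n,i}(x)=1$ for all $x\in[0,1]$. Assume that for every $x\in[0,1]$, $\delta_n(x)=\min_{0\le i\le l_n}|x-x_{n,i}|\to0$ as $n\to\infty$. For $f:[0,1]\to\mathbb R$ and $F:[0,1]\to\mathfrak J$ define $$\widetilde O_n(f,x)=\sum_{i=0}^{l_n}c_{n,i}(x)f(x_{n,i}),\qquad O_n(F,x)=\bigotimes_{i=0}^{l_n}c_{n,i}(x)F(x_{n,i}).$$ Assume that for any continuous $f:[0,1]\to\mathbb R$ and any $\epsilon>0$ there exists $\widetilde N_{f,\epsilon}$ such that $|f(x)-\widetilde O_n(f,x)|<\epsilon$ for all $n\ge\widetilde N_{f,\epsilon}$ and all $x\in[0,1]$. Then for any $F:[0,1]\to\mathfrak J$ continuous with respect to $d_\mu$ and any $\epsilon>0$ there exists $N_{F,\epsilon}$ such that for all $n\ge N_{F,\epsilon}$ and all $x\in[0,1]$, $$d_\mu\big(F(x),O_n(F,x)\big)<\epsilon.$$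
   Context: Fix $m\ge1$ and let $\mu$ be Lebesgue measure on $\mathbb R^m$. $\mathbb J$ denotes the collection of Jordan measurable subsets of $\mathbb R^m$ (bounded sets whose boundary has Lebesgue measure zero). $\operatorname{ci}(A)$ is the closure of the interior of $A$; a bounded set $A$ is regular compact if $A=\operatorname{ci}(A)$. $\mathfrak J\subset\mathbb J$ is the collection of regular compact sets in $\mathbb J$ (including $\emptyset$), with the metric $d_\mu(A,B)=\mu(A\Delta B)$, $\Delta$ being symmetric difference. A subset-generating function is a map $\Psi:\mathbb J\times[0,1]\to\mathfrak J$ such that for all $A\in\mathbb J$ and $s,t\in[0,1]$: (1) $\Psi(A,t)\subseteq A$ up to a null set, i.e. $\mu(\Psi(A,t)\setminus A)=0$; (2) $\mu(\Psi(A,t))=t\,\mu(A)$; (3) $\Psi(A,s)\subseteq\Psi(A,t)$ if $s\le t$. A subset-generating function $\Psi$ is fixed. For $A_0,\dots,A_n\in\mathfrak J$ and nonempty $\chi\subseteq\{0,\dots,n\}$ put $\Omega_\chi=\big(\bigcap_{k\in\chi}A_k\big)\setminus\big(\bigcup_{l\in\{0,\dots,n\}\setminus\chi}A_l\big)$, and $\Omega_\emptyset=\emptyset$. For weights $\alpha_i\in[0,1]$ with $\sum_i\alpha_i=1$, the partition average is $\bigotimes_{i=0}^n\alpha_iA_i:=\bigcup_{\chi\subseteq\{0,\dots,n\}}\Psi\big(\Omega_\chi,\sum_{k\in\chi}\alpha_k\big)\in\mathfrak J$. *)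

(* Defs.v *)
(* R^m is represented by row vectors, with their sup norm and topology. *)
From HB Require Import structures.
From mathcomp Require Export all_boot all_order all_algebra.
From mathcomp Require Export all_classical all_reals all_analysis.
Export Order.TTheory GRing.Theory Num.Theory.
Export numFieldNormedType.Exports.

Set Implicit Arguments.
Unset Strict Implicit.
Unset Printing Implicit Defensive.

Local Open Scope classical_set_scope.
Local Open Scope ring_scope.

Section LebesgueRm.
Variables (R : realType) (m : nat).
Implicit Types (a b : 'rV[R]_m) (A B : set 'rV[R]_m).

Definition box a b : set 'rV[R]_m :=
  [set x | forall i : 'I_m, a ord0 i <= x ord0 i <= b ord0 i].

(* For 0 < m, this is 0 as soon as b i <= a i for some i. *)
Definition box_volume a b : R :=
  \prod_(i < m) Num.max 0 (b ord0 i - a ord0 i).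

(* Lebesgue outer measure on R^m (meaningful for 0 < m): the infimum of the
   total volumes of the countable coverings by closed boxes. Lebesgue measure is
   its restriction to the Caratheodory measurable sets; Jordan measurable sets
   need not be Borel, but they are Caratheodory measurable, and this file only
   evaluates it on such sets and on their differences. *)
Definition lebesgue_Rm A : \bar R :=
  ereal_inf [set (\sum_(k <oo) (box_volume (ab k).1 (ab k).2)%:E)%E
            | ab in [set ab : nat -> 'rV[R]_m * 'rV[R]_m |
                      A `<=` \bigcup_k box (ab k).1 (ab k).2]].

Definition boundary A : set 'rV[R]_m := closure A `\` interior A.

Definition jordan_measurable A : Prop :=
  bounded_set A /\ lebesgue_Rm (boundary A) = 0%E.

Definition ci A : set 'rV[R]_m := closure (interior A).

Definition regular_compact A : Prop := bounded_set A /\ A = ci A.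

Definition regular_jordan A : Prop := jordan_measurable A /\ regular_compact A.

(* Extended-real valued, but finite on bounded sets. *)
Definition d_mu A B : \bar R := lebesgue_Rm (A `+` B).

(* Psi is a total function constrained only on Jordan measurable sets and on
   parameters in [0, 1]; its other values are irrelevant. *)
Definition subset_generating (Psi : set 'rV[R]_m -> R -> set 'rV[R]_m) : Prop :=
  forall A, jordan_measurable A ->
    [/\ forall t, t \in `[0, 1] -> regular_jordan (Psi A t),
        forall t, t \in `[0, 1] -> lebesgue_Rm (Psi A t `\` A) = 0%E,
        forall t, t \in `[0, 1] ->
          lebesgue_Rm (Psi A t) = (t%:E * lebesgue_Rm A)%E
      & forall s t, s \in `[0, 1] -> t \in `[0, 1] -> s <= t ->
          Psi A s `<=` Psi A t].

(* The case chi = set0 is separate: an empty intersection would be setT. *)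
Definition Omega (n : nat) (A : 'I_n.+1 -> set 'rV[R]_m) (chi : {set 'I_n.+1}) :
    set 'rV[R]_m :=
  if chi == finset.set0 then set0 else
  (\bigcap_(k in [set k | k \in chi]) A k) `\`
  (\bigcup_(l in [set l | l \notin chi]) A l).

Definition partition_average (Psi : set 'rV[R]_m -> R -> set 'rV[R]_m) (n : nat)
    (alpha : 'I_n.+1 -> R) (A : 'I_n.+1 -> set 'rV[R]_m) : set 'rV[R]_m :=
  \bigcup_(chi in [set: {set 'I_n.+1}])
    Psi (Omega A chi) (\sum_(k in chi) alpha k).

Definition d_mu_continuous (F : R -> set 'rV[R]_m) : Prop :=
  forall x, x \in `[0, 1] -> forall eps : R, 0 < eps ->
    exists2 delta : R, 0 < delta & forall y, y \in `[0, 1] ->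
      `|x - y| < delta -> (d_mu (F x) (F y) < eps%:E)%E.

End LebesgueRm.

Section Operators.
Variables (R : realType) (m n : nat).
Variables (xs : 'I_n.+1 -> R) (c : 'I_n.+1 -> R -> R).

Definition node_dist (x : R) : R :=
  \big[Num.min/`|x - xs ord0|]_(i < n.+1) `|x - xs i|.

Definition real_operator (f : R -> R) (x : R) : R :=
  \sum_(i < n.+1) c i x * f (xs i).

Definition set_operator (Psi : set 'rV[R]_m -> R -> set 'rV[R]_m)
    (F : R -> set 'rV[R]_m) (x : R) : set 'rV[R]_m :=
  partition_average Psi (fun i => c i x) (fun i => F (xs i)).

End Operators.

(* Main.v *)
(* For sets B and A_i, the average O of the A_i satisfies
   mu(B Delta O) <= 2 sum_i alpha_i mu(B Delta A_i). To see this, cut space into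
   the cells on which membership in every A_i is constant. On a cell E where the
   indices i with E inside A_i have total weight w, the set O is up to null sets
   a piece of E of measure w mu(E), in uncontrolled position, while the right
   side without the factor 2 is w mu(E \ B) + (1 - w) mu(E /\ B).
   With A_i = F(x_i) and B = F(x), the right side is 2 O~_n(g_x, x), where
   g_z(y) = d_mu(F(z), F(y)) is continuous and g_x(x) = 0. For x close to a fixed
   z, the triangle inequality replaces g_x by g_z, to which the hypothesis on
   real functions applies; compactness of [0, 1] makes the bound uniform. *)
From HB Require Import structures.
Require Import Defs.
From mathcomp Require Import lra.

Set Implicit Arguments.
Unset Strict Implicit.
Unset Printing Implicit Defensive.

Local Open Scope classical_set_scope.
Local Open Scope ring_scope.

(** * Lebesgue outer measure on R^m and Caratheodory measurability of Jordan sets *)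

Lemma box_volume_ge0 (R : realType) (m : nat) (a b : 'rV[R]_m) :
  0 <= box_volume a b.
Proof. by apply: prodr_ge0 => i _; rewrite le_max lexx. Qed.

(** The dimension is a successor because the empty product is 1. Degenerate boxes then pad a finite
    covering into a sequence at no cost. *)
Lemma box_volume0 (R : realType) (m : nat) : box_volume (0 : 'rV[R]_m.+1) 0 = 0.
Proof. by rewrite /box_volume big_ord_recl mxE subrr maxxx mul0r. Qed.

Section OuterMeasure.
Variables (R : realType) (m : nat).
Local Notation lambda := (@lebesgue_Rm R m.+1).
Local Open Scope ereal_scope.

Lemma lebesgue_Rm_le_cover (A : set 'rV[R]_m.+1)
    (ab : nat -> 'rV[R]_m.+1 * 'rV[R]_m.+1) :
  A `<=` \bigcup_k box (ab k).1 (ab k).2 ->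
  lambda A <= \sum_(k <oo) (box_volume (ab k).1 (ab k).2)%:E.
Proof. by move=> Aab; apply: ereal_inf_lbound; exists ab. Qed.

Lemma lebesgue_Rm_ge0 (A : set 'rV[R]_m.+1) : 0 <= lambda A.
Proof.
apply: le_ereal_inf_tmp => _ [ab _ <-].
by apply: nneseries_ge0 => k _ _; rewrite lee_fin box_volume_ge0.
Qed.

Lemma lebesgue_Rm_box (a b : 'rV[R]_m.+1) :
  lambda (box a b) <= (box_volume a b)%:E.
Proof.
pose ab k : 'rV[R]_m.+1 * 'rV[R]_m.+1 := if k is 0%N then (a, b) else (0%R, 0%R).
apply: (le_trans (@lebesgue_Rm_le_cover _ ab _)); first by move=> x ?; exists 0%N.
rewrite nneseries_recl//; last by move=> k; rewrite lee_fin box_volume_ge0.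
rewrite eseries_cond eseries0 ?adde0// => -[|k]//= _ _.
by rewrite box_volume0.
Qed.

Lemma lebesgue_Rm0 : lambda set0 = 0.
Proof.
apply/eqP; rewrite eq_le lebesgue_Rm_ge0 andbT.
apply: (le_trans (@lebesgue_Rm_le_cover _ (fun=> (0%R, 0%R)) _)) => //.
by rewrite eseries0// => k _ _; rewrite box_volume0.
Qed.

Lemma le_lebesgue_Rm : {homo lambda : A B / A `<=` B >-> A <= B}.
Proof.
move=> A B AB; apply: le_ereal_inf_tmp => _ [ab Bab <-].
by apply: lebesgue_Rm_le_cover; exact: subset_trans Bab.
Qed.

(** If every [A n] has finite outer measure, cover it within [e / 2 ^ n.+1] of its infimum, and
    enumerate the resulting double sequence of boxes along a bijection from [nat] to [nat * nat]. *)
Lemma lebesgue_Rm_sigma_subadditive : sigma_subadditive lambda.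
Proof.
move=> A; have [[i Aoo]|] := pselect (exists i, lambda (A i) = +oo).
  rewrite (eseries_pinfty _ _ Aoo) ?leey// => n _.
  by rewrite -ltNye (lt_le_trans _ (lebesgue_Rm_ge0 _)).
rewrite -forallNE => Afin.
apply/lee_addgt0Pr => e e0.
apply: le_trans (epsilon_trick _ (fun n => lebesgue_Rm_ge0 (A n)) (ltW e0)).
pose P n (ab : nat -> 'rV[R]_m.+1 * 'rV[R]_m.+1) :=
  A n `<=` \bigcup_k box (ab k).1 (ab k).2 /\
  \sum_(k <oo) (box_volume (ab k).1 (ab k).2)%:E
    <= lambda (A n) + (e / (2 ^ n.+1)%:R)%:E.
have [G PG] : {G & forall n, P n (G n)}.
  apply: (@choice _ _ P) => n.
  have en0 : (0 < e / (2 ^ n.+1)%:R)%R by rewrite divr_gt0// ltr0n expn_gt0.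
  have An_fin : lambda (A n) \is a fin_num.
    by rewrite ge0_fin_numE ?lebesgue_Rm_ge0// lt_neqAle leey andbT; exact/eqP.
  have [_ [ab Aab <-] /ltW abA] := lb_ereal_inf_adherent en0 An_fin.
  by exists ab; split.
pose vol (p : nat * nat) := (box_volume (G p.1 p.2).1 (G p.1 p.2).2)%:E.
have vol_ge0 p : 0 <= vol p by rewrite lee_fin box_volume_ge0.
have /card_esym/card_set_bijP[f fbij] := card_nat2.
apply: (@le_trans _ _ (\sum_(k <oo) vol (f k))).
  apply: (@lebesgue_Rm_le_cover _ (fun k => G (f k).1 (f k).2)) => x [n _ Ax].
  have [k _ Gx] := (PG n).1 x Ax.
  have [_ _ /(_ (n, k) I)[j _ fj]] := fbij.
  by exists j => //; rewrite fj.
rewrite nneseries_esumT; last by move=> k; exact: vol_ge0.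
rewrite -(reindex_esum [set: nat] [set: nat * nat] f vol fbij).
have -> : [set: nat * nat] = [set: nat] `*`` (fun=> [set: nat]).
  by apply/seteqP; split.
rewrite -(@esum_esum _ _ _ _ _ (fun i j => vol (i, j)))//.
rewrite -nneseries_esumT => [|n]; last exact: esum_ge0.
apply: lee_nneseries => n _; first by move=> _; exact: esum_ge0.
by rewrite -nneseries_esumT//; exact: (PG n).2.
Qed.

HB.instance Definition _ := isOuterMeasure.Build R 'rV[R]_m.+1 lambda
  lebesgue_Rm0 lebesgue_Rm_ge0 le_lebesgue_Rm lebesgue_Rm_sigma_subadditive.

Lemma box_volume_split (a b : 'rV[R]_m.+1) (i : 'I_m.+1) (t : R) :
  (box_volume a (\row_j if j == i then Num.min (b ord0 j) t else b ord0 j) +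
   box_volume (\row_j if j == i then Num.max (a ord0 j) t else a ord0 j) b
  <= box_volume a b)%R.
Proof.
pose P := (\prod_(j < m.+1 | j != i) Num.max 0 (b ord0 j - a ord0 j))%R.
have box_volumeE (u v : 'rV[R]_m.+1) :
    (forall j, j != i -> u ord0 j = a ord0 j /\ v ord0 j = b ord0 j) ->
    box_volume u v = (Num.max 0 (v ord0 i - u ord0 i) * P)%R.
  move=> uv; rewrite /box_volume (bigD1 i)//=; congr (_ * _)%R.
  by apply: eq_bigr => j /uv[-> ->].
rewrite !box_volumeE; [|by []|by move=> j /negbTE ji; rewrite !mxE ji..].
rewrite !mxE eqxx.
rewrite -mulrDl ler_wpM2r//; first by apply: prodr_ge0 => j _; rewrite le_max lexx.
move: (a ord0 i) (b ord0 i) => x y.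
case: (leP y t) => yt; case: (leP x t) => xt;
  rewrite /Num.max; repeat case: ltP => ?; lra.
Qed.

(** Cutting every box of a covering of [X] along the hyperplane splits it into coverings of the two
    parts of [X], without increasing the total volume. *)
Lemma caratheodory_halfspace (i : 'I_m.+1) (t : R) :
  lambda.-caratheodory [set x | (x ord0 i <= t)%R].
Proof.
apply: le_caratheodory_measurable => X.
apply: le_ereal_inf_tmp => _ [ab Xab <-].
pose lo k : 'rV[R]_m.+1 * 'rV[R]_m.+1 := ((ab k).1,
  \row_j if j == i then Num.min ((ab k).2 ord0 j) t else (ab k).2 ord0 j).
pose hi k : 'rV[R]_m.+1 * 'rV[R]_m.+1 := (
  \row_j if j == i then Num.max ((ab k).1 ord0 j) t else (ab k).1 ord0 j,
  (ab k).2).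
apply: (@le_trans _ _ (\sum_(k <oo) (box_volume (lo k).1 (lo k).2)%:E +
                       \sum_(k <oo) (box_volume (hi k).1 (hi k).2)%:E)).
  apply: leeD; apply: lebesgue_Rm_le_cover => x -[/Xab[k _ xab] /= xt];
    exists k => // j; rewrite /= !mxE; have /andP[ax xb] := xab j;
    case: eqP => [ji|_]; rewrite ?ax ?xb ?andbT//=.
  - by rewrite le_min xb ji.
  - by rewrite ge_max ax ji /= leNgt; apply/negP => /ltW.
rewrite -nneseriesD; last 2 first.
  by move=> k _ _; rewrite lee_fin box_volume_ge0.
  by move=> k _ _; rewrite lee_fin box_volume_ge0.
apply: lee_nneseries => k _; first by rewrite -EFinD lee_fin addr_ge0 ?box_volume_ge0.
by rewrite -EFinD lee_fin box_volume_split.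
Qed.

(** An open set is the countable union of the half-open boxes with rational corners that it
    contains, and such boxes are finite intersections of differences of half-spaces. *)
Lemma caratheodory_open (U : set 'rV[R]_m.+1) :
  open U -> lambda.-caratheodory U.
Proof.
move=> Uopen.
pose cell (pq : 'rV[rat]_m.+1 * 'rV[rat]_m.+1) : set 'rV[R]_m.+1 :=
  \bigcap_(i in [set: 'I_m.+1])
    ([set x | (x ord0 i <= ratr (pq.2 ord0 i))%R] `\`
     [set x | (x ord0 i <= ratr (pq.1 ord0 i))%R]).
have cell_meas pq : lambda.-cara.-measurable (cell pq).
  apply: fin_bigcap_measurable => // i _; apply: measurableD;
  exact: caratheodory_halfspace.
have -> : U = \bigcup_pq (if `[< cell pq `<=` U >] then cell pq else set0).
  apply/seteqP; split => [x Ux|x [pq _]]; last first.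
    by case: asboolP => // cU; exact: cU.
  have /nbhs_ballP[e /= e0 xeU] : nbhs x U by rewrite nbhsE; exists U => //; split.
  (* Corners within [e] of [x] in each coordinate keep the box inside the sup-norm ball. *)
  have /choice[p pP] (i : 'I_m.+1) := @rat_in_itvoo _ (x ord0 i - e) (x ord0 i)
    (ltac:(lra)).
  have /choice[q qP] (i : 'I_m.+1) := @rat_in_itvoo _ (x ord0 i) (x ord0 i + e)
    (ltac:(lra)).
  exists (\row_i p i, \row_i q i) => //; case: asboolP => [_|[]].
    move=> i _ /=; rewrite !mxE; have := pP i; have := qP i; rewrite !in_itv/=.
    by move=> /andP[/ltW ? _] /andP[_ ?]; split => //; apply/negP; rewrite -ltNge.
  move=> y cy; apply: xeU; split => // j i; rewrite (ord1 j) /ball/= ltr_norml.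
  have [/= + /negP] := cy i I; rewrite !mxE -ltNge.
  have := pP i; have := qP i; rewrite !in_itv/=.
  by move=> /andP[? ?] /andP[? ?] ? ?; apply/andP; split; lra.
apply: (@countable_bigcupT_measurable _ (caratheodory_type lambda)) => [|pq].
  exact: countableP.
by case: ifP => _ //; exact: measurable0.
Qed.

Lemma caratheodory_null (A : set 'rV[R]_m.+1) :
  lambda A = 0 -> lambda.-caratheodory A.
Proof.
move=> A0; apply: le_caratheodory_measurable => X /=.
have -> : lambda (X `&` A) = 0.
  apply/eqP; rewrite eq_le lebesgue_Rm_ge0 andbT -A0.
  by apply: le_lebesgue_Rm; exact: subIsetr.
by rewrite add0e; apply: le_lebesgue_Rm; exact: subIsetl.
Qed.

(** The set is its open interior together with a part of its null boundary. *)
Lemma caratheodory_jordan (A : set 'rV[R]_m.+1) :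
  jordan_measurable A -> lambda.-caratheodory A.
Proof.
move=> [_ dA0]; have -> : A = interior A `|` (A `\` interior A).
  by rewrite setDUK//; exact: interior_subset.
apply: caratheodory_measurable_setU.
  by apply: caratheodory_open; exact: open_interior.
apply/caratheodory_null/eqP; rewrite eq_le lebesgue_Rm_ge0 andbT -dA0.
by apply: le_lebesgue_Rm; apply: setSD; exact: subset_closure.
Qed.

Lemma lebesgue_Rm_bounded_fin (A : set 'rV[R]_m.+1) :
  bounded_set A -> lambda A \is a fin_num.
Proof.
move=> [M [_ MA]]; rewrite ge0_fin_numE ?lebesgue_Rm_ge0//.
have AM : A `<=` box (const_mx (- (M + 1))%R) (const_mx (M + 1)%R).
  move=> x /(MA (M + 1)%R (ltac:(lra))) xM i; rewrite !mxE -ler_norml.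
  by apply: le_trans xM; rewrite [leRHS]mx_normrE; apply: (le_bigmax _ _ (ord0, i)).
apply: le_lt_trans (ltry (box_volume (const_mx (- (M + 1))%R : 'rV[R]_m.+1)
  (const_mx (M + 1)%R))).
exact: le_trans (le_lebesgue_Rm AM) (lebesgue_Rm_box _ _).
Qed.

End OuterMeasure.

(** * Finite sub- and superadditivity of outer measures *)

Section FiniteFamilies.
Variables (R : realType) (T : Type) (mu : {outer_measure set T -> \bar R}).
Local Open Scope ereal_scope.

Lemma outer_measure_bigcup_fin (I : finType) (F : I -> set T) :
  mu (\bigcup_i F i) <= \sum_i mu (F i).
Proof.
have -> : \bigcup_i F i = \big[setU/set0]_(i : I) F i.
  rewrite -bigcup_seq; congr bigcup; apply/seteqP.
  by split => i //= _; rewrite mem_index_enum.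
elim/big_ind2: _ => [|x A y B Ax By|//]; first by rewrite outer_measure0.
by rewrite (le_trans (outer_measureU2 mu A B))// leeD.
Qed.

(** Splitting [X] along one [F i] is exact, and by disjointness the other [F j] lie in the
    complement that remains, so induction applies there. *)
Lemma caratheodory_superadditive (I : finType) (F : I -> set T) (X : set T) :
  (forall i, mu.-caratheodory (F i)) -> trivIset setT F ->
  \sum_i mu (X `&` F i) <= mu X.
Proof.
move=> Fm Fdisj; elim: (index_enum I) (index_enum_uniq I) X => [|i s IH] /= us X.
  by rewrite big_nil outer_measure_ge0.
have /andP[is_ us'] := us.
rewrite big_cons [leRHS](Fm i) leeD2l//.
apply: le_trans (IH us' (X `&` ~` F i)).
rewrite !big_seq; apply: lee_sum => j js.
apply: le_outer_measure => x [Xx Fj]; split => //; split => // Fi.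
suff ij : i = j by rewrite ij js in is_.
exact: (Fdisj i j Logic.I Logic.I (ex_intro _ x (conj Fi Fj))).
Qed.

End FiniteFamilies.

(** * Jordan measurable sets and volumes of bounded sets *)

Lemma bounded_subset (R : realType) (m : nat) (A B : set 'rV[R]_m) :
  A `<=` B -> bounded_set B -> bounded_set A.
Proof.
by move=> AB [M [Mr MB]]; exists M; split => // y /MB By x /AB; exact: By.
Qed.

Lemma near_not_boundary (R : realType) (m : nat) (A : set 'rV[R]_m) x :
  ~ boundary A x -> \forall y \near x, A y <-> A x.
Proof.
move=> nAx; have [Ax|nix] := pselect (interior A x).
  by apply: filterS (Ax) => y Ay; split => // _; exact: interior_subset.
have ncx : (~` A)°%classic x by rewrite interiorC => cx; apply: nAx.
by apply: filterS (ncx) => y nAy; split => // /(interior_subset ncx).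
Qed.

Section JordanSets.
Variables (R : realType) (m : nat).
Implicit Types A B E P X : set 'rV[R]_m.+1.
Local Notation lambda := (@lebesgue_Rm R m.+1).

(** The second hypothesis makes [X] a union of cells of the family [A]. Away from all the boundaries
    of the [A i], membership in each of them is locally constant, hence so is membership in [X]; the
    boundary of [X] is thus inside a finite union of null sets. *)
Lemma jordan_boolean_combination (I : finType) (A : I -> set 'rV[R]_m.+1) X :
  (forall i, jordan_measurable (A i)) ->
  (forall x y, (forall i, A i x <-> A i y) -> X x -> X y) ->
  bounded_set X -> jordan_measurable X.
Proof.
move=> Aj XA Xb; split => //.
have dX : boundary X `<=` \bigcup_i boundary (A i).
  move=> x [cx nix]; apply: contrapT => nx; apply: nix.
  have nearA : \forall y \near x, forall i, A i y <-> A i x.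
    apply: (@filter_forall _ _ (fun i => [set y | A i y <-> A i x]) (nbhs x)) => i.
    apply: near_not_boundary => dx.
    by apply: nx; exists i.
  have [y [Xy yA]] := cx _ nearA.
  by apply: filterS nearA => z zA; apply: (XA y) => // i; rewrite yA zA.
apply/eqP; rewrite eq_le lebesgue_Rm_ge0 andbT.
apply: (le_trans (le_lebesgue_Rm dX)).
apply: (le_trans (outer_measure_bigcup_fin _ _)).
by rewrite big1// => i _; exact: (Aj i).2.
Qed.

(* [fine] sends an infinite measure to 0: [vol] is only meaningful on bounded
   sets. *)
Definition vol X : R := fine (lambda X).

Lemma volE X : bounded_set X -> lambda X = (vol X)%:E.
Proof. by move=> Xb; rewrite fineK// lebesgue_Rm_bounded_fin. Qed.

Lemma vol_ge0 X : 0 <= vol X.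
Proof. by rewrite fine_ge0// lebesgue_Rm_ge0. Qed.

Lemma le_vol A B : bounded_set B -> A `<=` B -> vol A <= vol B.
Proof.
move=> Bb AB; rewrite fine_le ?lebesgue_Rm_bounded_fin//; last exact: le_lebesgue_Rm.
exact: bounded_subset Bb.
Qed.

Lemma vol_split A X : lambda.-caratheodory A -> bounded_set X ->
  vol X = vol (X `&` A) + vol (X `\` A).
Proof.
move=> Am Xb; rewrite /vol [lambda X]Am fineD//; apply: lebesgue_Rm_bounded_fin;
by apply: bounded_subset Xb => x -[].
Qed.

Lemma bounded_symdiff A B :
  bounded_set A -> bounded_set B -> bounded_set (A `+` B).
Proof.
move=> [M [_ MA]] [N [_ NB]]; exists (Num.max M N); split; first exact: num_real.
by move=> y; rewrite gt_max => /andP[/MA Ay /NB By] x [[/Ay]|[/By]].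
Qed.

Lemma vol_symdiff_triangle A B C :
  bounded_set A -> bounded_set B -> bounded_set C ->
  vol (A `+` C) <= vol (A `+` B) + vol (B `+` C).
Proof.
move=> Ab Bb Cb; rewrite -lee_fin EFinD -!volE; try exact: bounded_symdiff.
apply: le_trans (outer_measureU2 _ _ _); apply: le_lebesgue_Rm => x /=.
by have [|] := pselect (B x); tauto.
Qed.

(* The constant 2 is attained for w = 1/2, B half of E and P the other half. *)
Lemma vol_symdiff_cell_le B E P (w : R) :
  jordan_measurable B -> jordan_measurable E -> jordan_measurable P ->
  0 <= w <= 1 -> vol P = w * vol E -> lambda (P `\` E) = 0%E ->
  vol ((B `+` P) `&` E) <= 2 * (w * vol (E `\` B) + (1 - w) * vol (E `&` B)).
Proof.
move=> Bj Ej Pj /andP[w0 w1] volP PE0.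
have [[Bb Eb] Pb] := (Bj.1, Ej.1, Pj.1).
have [[Bm Em] Pm] := (caratheodory_jordan Bj, caratheodory_jordan Ej,
  caratheodory_jordan Pj).
have Sb : bounded_set ((B `+` P) `&` E) by apply: bounded_subset Eb => x -[].
have SB := vol_split Bm Sb.
have EB := vol_split Bm Eb.
have EP := vol_split Pm Eb.
have := vol_split Em Pb; rewrite [vol (P `\` E)]/vol PE0 addr0 setIC => PE.
have a1 : vol (((B `+` P) `&` E) `\` B) <= vol P.
  by apply: le_vol => // x /=; tauto.
have a2 : vol (((B `+` P) `&` E) `\` B) <= vol (E `\` B).
  by apply: le_vol => [|x /=]; [apply: bounded_subset Eb => x -[]|tauto].
have b1 : vol (((B `+` P) `&` E) `&` B) <= vol (E `\` P).
  by apply: le_vol => [|x /=]; [apply: bounded_subset Eb => x -[]|tauto].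
have b2 : vol (((B `+` P) `&` E) `&` B) <= vol (E `&` B).
  by apply: le_vol => [|x /=]; [apply: bounded_subset Eb => x -[]|tauto].
have V0 := vol_ge0 (E `\` B); have V1 := vol_ge0 (E `&` B).
rewrite SB; move: V0 V1 a1 a2 b1 b2.
(* Since [P] lies in [E] up to a null set, its complement in [E] takes the remaining fraction
   [1 - w]. *)
have -> : vol (E `\` P) = (1 - w) * (vol (E `&` B) + vol (E `\` B)).
  by move: EP; rewrite -PE volP EB; lra.
rewrite volP EB.
move: (vol (E `\` B)) (vol (E `&` B)) (vol (_ `&` E `&` B)) (vol (_ `&` E `\` B)).
move=> V W b a V0 V1 a1 a2 b1 b2.
(* The bounds to add are, in order, [a1] and [b1], [a2] and [b1], [a1] and [b2], [a1] and [b1]. The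
   nonnegative products [h1], [h2] make up exactly the gap between their sum and the right side. *)
have [w2|/ltW w2] := leP 1 (2 * w); have [VW|/ltW VW] := leP W V.
- have h1 : 0 <= (2 * w - 1) * (V - W) by apply: mulr_ge0; lra.
  lra.
- have h1 : 0 <= (1 - w) * (W - V) by apply: mulr_ge0; lra.
  have h2 : 0 <= (2 * w - 1) * V by apply: mulr_ge0; lra.
  lra.
- have h1 : 0 <= w * (V - W) by apply: mulr_ge0; lra.
  have h2 : 0 <= (1 - 2 * w) * W by apply: mulr_ge0; lra.
  lra.
- have h1 : 0 <= (1 - 2 * w) * (W - V) by apply: mulr_ge0; lra.
  lra.
Qed.

End JordanSets.

(** * Distance from a set to a partition average *)

Section PartitionAverage.
Variables (R : realType) (m n : nat).
Variables (Psi : set 'rV[R]_m.+1 -> R -> set 'rV[R]_m.+1).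
Variables (alpha : 'I_n.+1 -> R) (A : 'I_n.+1 -> set 'rV[R]_m.+1).
Variables (B : set 'rV[R]_m.+1).
Hypothesis Psi_gen : subset_generating Psi.
Hypothesis alpha_ge0 : forall i, 0 <= alpha i.
Hypothesis alpha_sum : \sum_i alpha i = 1.
Hypothesis A_jordan : forall i, jordan_measurable (A i).
Hypothesis B_jordan : jordan_measurable B.
Implicit Types chi : {set 'I_n.+1}.
Local Notation lambda := (@lebesgue_Rm R m.+1).

(** Differs from [Omega] only at [finset.set0], where it consists of the points in no [A k] instead
    of being empty; the cells thereby partition the whole space. *)
Definition cell chi : set 'rV[R]_m.+1 := [set x | forall k, A k x <-> k \in chi].

Lemma cell_OmegaE chi : chi != finset.set0 -> Omega A chi = cell chi.
Proof.
move=> chi0; rewrite /Omega (negbTE chi0); apply/seteqP; split=> x /=.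
  move=> [Ax nAx] k; split; last exact: Ax.
  by move=> Akx; apply: contrapT => /negP kchi; apply: nAx; exists k.
move=> xchi; split => [k /= kchi|]; first exact/xchi.
by move=> [k /= /negP kchi] /xchi.
Qed.

Lemma caratheodory_cell chi : lambda.-caratheodory (cell chi).
Proof.
have -> : cell chi = \bigcap_(k in [set: 'I_n.+1])
    (if k \in chi then A k else ~` A k).
  apply/seteqP; split=> x xchi k.
    by move=> _; case: ifP => kchi; [exact/xchi|move=> /xchi; rewrite kchi].
  by have := xchi k Logic.I; case: ifP => _; split.
apply: (@fin_bigcap_measurable _ (caratheodory_type lambda)) => // k _.
have Ak := caratheodory_jordan (A_jordan k).
by case: ifP => _ //; exact: caratheodory_measurable_setC.
Qed.

Lemma trivIset_cell : trivIset setT cell.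
Proof.
move=> chi chi' _ _ [x [xc xc']]; apply/setP => k.
by apply/idP/idP => [/xc/xc'|/xc'/xc].
Qed.

Lemma jordan_Omega chi : jordan_measurable (Omega A chi).
Proof.
apply: (jordan_boolean_combination A_jordan) => [x y Axy|].
  rewrite /Omega; case: eqP => // _ [Ax nAx]; split=> [k kchi|[k kchi Aky]].
    exact/Axy/Ax.
  by apply: nAx; exists k => //; exact/Axy.
have [->|/finset.set0Pn[k kchi]] := eqVneq chi finset.set0.
  rewrite /Omega eqxx; exists 0; split => // ? ? ? [].
apply: bounded_subset (A_jordan k).1 => x.
by rewrite /Omega; case: eqP => // _ [/(_ k kchi)].
Qed.

Let weight chi : R := \sum_(k in chi) alpha k.

Lemma weight_itv chi : 0 <= weight chi <= 1.
Proof.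
rewrite sumr_ge0//= -alpha_sum [leRHS](bigID (mem chi))/= lerDl.
exact: sumr_ge0.
Qed.

Lemma weightC chi : 1 - weight chi = \sum_(k | k \notin chi) alpha k.
Proof. by rewrite /weight -alpha_sum (bigID (mem chi))/= addrAC subrr add0r. Qed.

Let piece chi : set 'rV[R]_m.+1 := Psi (Omega A chi) (weight chi).

(* On the cell of the points lying in no [A k] the average is negligible,
   so that only the part of [B] in that cell counts. *)
Let trace chi : set 'rV[R]_m.+1 :=
  if chi == finset.set0 then B `&` cell chi else (B `+` piece chi) `&` cell chi.

(** A point of [B] outside the average misses in particular the piece of its own cell. A point of
    the average outside [B] lies in some piece, either within the matching [Omega] set, which is
    then its cell, or in the part of the piece that sticks out. *)
Lemma symdiff_partition_average_sub :
  B `+` partition_average Psi alpha A `<=`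
  \bigcup_chi (trace chi `|` (piece chi `\` Omega A chi)).
Proof.
move=> x; pose chi : {set 'I_n.+1} := [set k | `[< A k x >]]%SET.
have xchi : cell chi x by move=> k; rewrite inE; split => /asboolP.
case=> [[Bx nOx]|[[psi _ xpsi] nBx]].
  have nPx : ~ piece chi x by move=> Px; apply: nOx; exists chi.
  by exists chi => //; left; rewrite /trace; case: eqP => _; split => //; left.
have [xO|nxO] := pselect (Omega A psi x); last by exists psi => //; right.
have psi0 : psi != finset.set0.
  by apply/eqP => psi0; move: xO; rewrite /Omega psi0 eqxx.
have xcpsi : cell psi x by rewrite -cell_OmegaE.
by exists psi => //; left; rewrite /trace (negbTE psi0); split => //; right.
Qed.

Lemma bounded_trace chi : bounded_set (trace chi).
Proof.
rewrite /trace; case: eqP => [_|/eqP chi0].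
  by apply: bounded_subset B_jordan.1 => x -[].
rewrite -cell_OmegaE//.
by apply: bounded_subset (jordan_Omega chi).1 => x -[].
Qed.

(** On a cell [E], each [B + A i] (symmetric difference) reduces to [E] minus [B] or to [E] meet [B]
    according to whether [i] is in [chi]. Grouping the weights gives the right side of the estimate
    for one cell. *)
Lemma vol_trace_le chi :
  vol (trace chi) <= 2 * \sum_i alpha i * vol ((B `+` A i) `&` cell chi).
Proof.
have cellE i : (B `+` A i) `&` cell chi =
    if i \in chi then cell chi `\` B else cell chi `&` B.
  apply/seteqP; split => x; case: ifPn => ichi.
  - by move=> [/= + xc]; have := proj2 (xc i) ichi; tauto.
  - move=> [/= + xc]; have : ~ A i x by move=> /xc; rewrite (negbTE ichi).
    by tauto.
  - by move=> [xc nBx]; have := proj2 (xc i) ichi; split => //; right.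
  - move=> [xc Bx]; split => //; left; split => //.
    by move=> /xc; rewrite (negbTE ichi).
under eq_bigr => i _ do rewrite cellE.
(* For empty [chi] the cell is unbounded, so the estimate for Jordan cells does not apply; but the
   sum is then exactly the volume of the trace, and the factor 2 is slack. *)
rewrite /trace; case: eqP => [->|/eqP chi0].
  under eq_bigr => i _ do rewrite finset.in_set0.
  rewrite -mulr_suml alpha_sum mul1r setIC.
  by have := vol_ge0 (cell finset.set0 `&` B); lra.
rewrite (bigID (mem chi))/=.
rewrite [X in X + _](_ : _ = weight chi * vol (cell chi `\` B)); last first.
  by rewrite mulr_suml; apply: eq_bigr => i ->.
rewrite [X in _ + X](_ : _ = (1 - weight chi) * vol (cell chi `&` B)); last first.
  by rewrite weightC mulr_suml; apply: eq_bigr => i /negbTE ->.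
have w01 : weight chi \in `[0, 1] by rewrite in_itv/= weight_itv.
have [reg sub volP _] := Psi_gen (jordan_Omega chi).
rewrite -(cell_OmegaE chi0).
apply: vol_symdiff_cell_le => //.
- exact: jordan_Omega.
- exact: (reg _ w01).1.
- have := volP _ w01; rewrite (volE (jordan_Omega chi).1) -EFinM.
  by rewrite /vol => ->.
- exact: sub.
Qed.

(** Sum the cell estimates and exchange the two sums. For each [i], the parts of the symmetric
    difference of [B] and [A i] in the disjoint measurable cells add up to at most its volume. *)
Lemma d_mu_partition_average_le :
  (d_mu B (partition_average Psi alpha A)
    <= (2 * \sum_i alpha i * vol (B `+` A i))%:E)%E.
Proof.
apply: (le_trans (le_lebesgue_Rm symdiff_partition_average_sub)).
apply: (le_trans (outer_measure_bigcup_fin _ _)).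
apply: (@le_trans _ _ (\sum_chi (vol (trace chi))%:E)%E).
  apply: lee_sum => chi _.
  (* What the piece leaves outside its [Omega] set is null. *)
  apply: (le_trans (outer_measureU2 _ _ _)).
  have w01 : weight chi \in `[0, 1] by rewrite in_itv/= weight_itv.
  have [_ sub _ _] := Psi_gen (jordan_Omega chi).
  by rewrite -(volE (bounded_trace chi)) /piece [X in (_ + X)%E]sub// adde0.
rewrite sumEFin lee_fin; apply: (le_trans (ler_sum _ (fun chi _ => vol_trace_le chi))).
rewrite -mulr_sumr ler_pM2l// exchange_big/=; apply: ler_sum => i _.
rewrite -mulr_sumr ler_wpM2l//.
have BAb := bounded_symdiff B_jordan.1 (A_jordan i).1.
rewrite -lee_fin -(volE BAb) -sumEFin.
apply: le_trans (caratheodory_superadditive _ caratheodory_cell trivIset_cell).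
apply: lee_sum => chi _; rewrite -volE//.
by apply: bounded_subset BAb => x -[].
Qed.

End PartitionAverage.

(** * Set-valued functions on the unit interval and the uniform estimate *)

Lemma nodes_in_unit (R : realType) (l : nat) (xs : 'I_l.+1 -> R) :
  xs ord0 = 0 -> xs ord_max = 1 ->
  (forall i j : 'I_l.+1, (i < j)%N -> xs i < xs j) ->
  forall i, xs i \in `[0, 1].
Proof.
move=> xs0 xs1 incr i; rewrite in_itv/= -xs0 -xs1; apply/andP; split.
  have [->//|i0] := eqVneq i ord0; apply/ltW/incr => /=.
  by rewrite lt0n; apply: contra i0 => /eqP i0; apply/eqP/val_inj.
have [->//|il] := eqVneq i ord_max; apply/ltW/incr => /=.
by rewrite ltn_neqAle -ltnS ltn_ord andbT; apply: contra il => /eqP il; apply/eqP/val_inj.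
Qed.

Section SetValuedFunctions.
Variables (R : realType) (m : nat) (F : R -> set 'rV[R]_m.+1).
Hypothesis F_regular : forall x, x \in `[0, 1] -> regular_jordan (F x).
Hypothesis F_continuous : d_mu_continuous F.

Let F_bounded x : x \in `[0, 1] -> bounded_set (F x).
Proof. by move=> /F_regular[[]]. Qed.

Let F_close x y e : x \in `[0, 1] -> y \in `[0, 1] ->
  (d_mu (F x) (F y) < e%:E)%E -> vol (F x `+` F y) < e.
Proof.
move=> x01 y01; rewrite /d_mu volE ?lte_fin//.
by apply: bounded_symdiff; exact: F_bounded.
Qed.

Lemma continuous_vol_symdiff z : z \in `[0, 1] ->
  {within `[0, 1], continuous (fun y => vol (F z `+` F y))}.
Proof.
move=> z01; apply/subspace_continuousP => x x01.
apply/cvgrPdist_lt => e e0.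
have [d d0 Fd] := F_continuous x01 e0.
apply/nbhs_ballP; exists d => //= y xy y01.
have xyd := F_close x01 y01 (Fd y y01 xy).
have [zb xb yb] : [/\ bounded_set (F z), bounded_set (F x) & bounded_set (F y)].
  by split; exact: F_bounded.
(* The two triangle inequalities bound the change of the distance to [F z] by the distance from
   [F x] to [F y]. *)
have zxy := vol_symdiff_triangle zb xb yb.
have zyx := vol_symdiff_triangle zb yb xb.
rewrite [F y `+` F x]setYC in zyx.
change (`|vol (F z `+` F x) - vol (F z `+` F y)| < e).
by rewrite ltr_norml; apply/andP; split; lra.
Qed.

End SetValuedFunctions.

Theorem corollary6p2 (R : realType) (m : nat) (hm : (0 < m)%N)
  (Psi : set 'rV[R]_m -> R -> set 'rV[R]_m) (hPsi : subset_generating Psi)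
  (l : nat -> nat)
  (xs : forall n : nat, 'I_(l n).+1 -> R)
  (xs_first : forall n, xs n ord0 = 0)
  (xs_last : forall n, xs n ord_max = 1)
  (xs_incr : forall n (i j : 'I_(l n).+1), (i < j)%N -> xs n i < xs n j)
  (c : forall n : nat, 'I_(l n).+1 -> R -> R)
  (c_ge0 : forall n i x, x \in `[0, 1] -> 0 <= c n i x)
  (c_sum : forall n x, x \in `[0, 1] -> \sum_(i < (l n).+1) c n i x = 1)
  (nodes_dense : forall x, x \in `[0, 1] ->
     node_dist (xs n) x @[n --> \oo] --> (0 : R))
  (approx_real : forall f : R -> R, {within `[0, 1], continuous f} ->
     forall eps : R, 0 < eps -> exists N : nat,
       forall n, (N <= n)%N -> forall x, x \in `[0, 1] ->
         `|f x - real_operator (xs n) (c n) f x| < eps)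
  (F : R -> set 'rV[R]_m)
  (F_regular : forall x, x \in `[0, 1] -> regular_jordan (F x))
  (F_continuous : d_mu_continuous F)
  (eps : R) (eps_gt0 : 0 < eps) :
  exists N : nat, forall n, (N <= n)%N -> forall x, x \in `[0, 1] ->
    (d_mu (F x) (set_operator (xs n) (c n) Psi F x) < eps%:E)%E.
Proof.
case: m hm Psi hPsi F F_regular F_continuous => // m _ Psi hPsi F Freg Fcont.
pose P n x := x \in `[0, 1] ->
  (d_mu (F x) (set_operator (xs n) (c n) Psi F x) < eps%:E)%E.
suff [N _ PN] : \forall n \near \oo, [set` `[0 : R, 1]] `<=` P n.
  by exists N => n Nn x x01; exact: PN.
(* By compactness it suffices to find, around each [z], a ball and a rank beyond which the bound
   holds for all [x] in the ball. *)
have /compact_near_coveringP := @segment_compact R 0 1.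
apply=> z z01.
(* With [g] the distance to [F z], [g x] is below [eps / 8] and its approximation at [x] below
   [eps / 4]; twice their sum is below [3 * eps / 4]. *)
have e8 : 0 < eps / 8 by lra.
have [d d0 Fd] := Fcont z z01 _ e8.
have [N gN] := approx_real _ (continuous_vol_symdiff Freg Fcont z01) _ e8.
exists (ball z d, [set n | (N <= n)%N]).
  by split; [exact: nbhsx_ballx | exists N].
move=> [x n] [/= zx Nn] x01.
have xs01 i := nodes_in_unit (xs_first n) (xs_last n) (xs_incr n) i.
have Fb y : y \in `[0, 1] -> bounded_set (F y) by move=> /Freg[[]].
have gx : vol (F z `+` F x) < eps / 8.
  rewrite -lte_fin -volE; last by apply: bounded_symdiff; exact: Fb.
  exact: Fd.
have := gN n Nn x x01; rewrite /real_operator ltr_norml => /andP[gxs _].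
apply: (le_lt_trans (d_mu_partition_average_le hPsi _ _ _ _)).
- by move=> i; exact: c_ge0.
- exact: c_sum.
- by move=> i; exact: (Freg _ (xs01 i)).1.
- exact: (Freg x x01).1.
rewrite lte_fin.
have : \sum_i c n i x * vol (F x `+` F (xs n i)) <=
    \sum_i c n i x * (vol (F z `+` F x) + vol (F z `+` F (xs n i))).
  apply: ler_sum => i _; rewrite ler_wpM2l ?c_ge0// [F z `+` F x]setYC.
  by apply: vol_symdiff_triangle; exact: Fb.
under [leRHS]eq_bigr => i _ do rewrite mulrDr.
by rewrite big_split/= -mulr_suml c_sum// mul1r => ?; lra.
Qed.
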